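(* For every real number $c<\frac{4}{3}$ there exist a tree and an initial placement of tokens on it such that every sorting swap sequence that never swaps the token on a leaf while that leaf is happy has length greater than $c\cdot \mathrm{OPT}$, where $\mathrm{OPT}$ is the minimum length of a sorting swap sequence for that instance. In other words, any algorithm for token swapping on trees that never moves tokens at happy leaves has approximation factor at least $\frac43$.
   Context: Token swapping on a tree: the tree has vertices $v_1,\dots,v_n$ and tokens labelled $1,\dots,n$, one on each vertex. A swap exchanges the tokens on the two endpoints of an edge. A swap sequence sorts the tokens if afterwards token $i$ is on $v_i$ for every $i$. A token is home if it is on its destination vertex; a leaf is happy (at a given moment) if the token currently on it is home. The approximation factor of an algorithm is the supremum over instances of (number of swaps it outputs)/(minimum number of swaps). *)

(* Defs.v *)
From mathcomp Require Import all_boot all_order all_algebra all_fingroup.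
From mathcomp Require Import boolp classical_sets reals constructive_ereal ereal.

Set Implicit Arguments.
Unset Strict Implicit.
Unset Printing Implicit Defensive.

Definition acyclic (n : nat) (e : rel 'I_n) : Prop :=
  forall c : seq 'I_n, 2 < size c -> ~ ucycle e c.

Record is_tree (n : nat) (e : rel 'I_n) : Prop := IsTree {
  tree_nonempty : 0 < n;
  tree_sym : symmetric e;
  tree_irrefl : irreflexive e;
  tree_connected : forall u v : 'I_n, connect e u v;
  tree_acyclic : acyclic e
}.

Definition is_leaf (n : nat) (e : rel 'I_n) (v : 'I_n) : bool :=
  #|[pred w | e v w]| == 1.

(* A placement is a permutation [p], [p v] being the token on vertex [v];
   the destination of token [i] is vertex [i]. *)
Definition placement (n : nat) := 'S_n.

Definition is_home (n : nat) (p : placement n) (v : 'I_n) : bool := p v == v.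

Definition happy_leaf (n : nat) (e : rel 'I_n) (p : placement n) (v : 'I_n) :
    bool :=
  is_leaf e v && is_home p v.

(* [(s * t)%g x = t (s x)], so vertex [u] receives the token [p v] and
   vertex [v] the token [p u]. *)
Definition swap (n : nat) (p : placement n) (uv : 'I_n * 'I_n) : placement n :=
  (tperm uv.1 uv.2 * p)%g.

Definition swaps (n : nat) := seq ('I_n * 'I_n).

Definition run (n : nat) (p : placement n) (s : swaps n) : placement n :=
  foldl (@swap n) p s.

Definition on_edges (n : nat) (e : rel 'I_n) (s : swaps n) : bool :=
  all (fun uv => e uv.1 uv.2) s.

Fixpoint spares_happy_leaves (n : nat) (e : rel 'I_n) (p : placement n)
    (s : swaps n) : bool :=
  if s is uv :: s' then
    [&& ~~ happy_leaf e p uv.1, ~~ happy_leaf e p uv.2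
      & spares_happy_leaves e (swap p uv) s']
  else true.

Record instance := Instance {
  nverts : nat;
  edge : rel 'I_nverts;
  init_placement : placement nverts;
  edge_tree : is_tree edge
}.

Definition sorting (I : instance) (s : swaps (nverts I)) : Prop :=
  on_edges (@edge I) s /\ forall v, is_home (run (init_placement I) s) v.

Definition never_moves_happy_leaves (I : instance) (s : swaps (nverts I)) :
    Prop :=
  spares_happy_leaves (@edge I) (init_placement I) s.

Definition is_OPT (I : instance) (k : nat) : Prop :=
  (exists2 s : swaps (nverts I), sorting s & size s = k) /\
  (forall s : swaps (nverts I), sorting s -> k <= size s).

Definition sorting_algorithm (A : forall I : instance, swaps (nverts I)) : Prop :=
  forall I, sorting (A I).

(* Instances with OPT = 0 (already sorted) are left out of the supremum, their
   ratio being undefined. *)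
Definition approx_factor (R : realType)
    (A : forall I : instance, swaps (nverts I)) : \bar R :=
  ereal_sup [set x : \bar R | exists (I : instance) (k : nat),
    [/\ is_OPT I k, 0 < k & x = (((size (A I))%:R / k%:R)%R : R)%:E]]%classic.

(* Main.v *)
(* Take a path with [2k+1] vertices whose tokens are in reverse order, and
   attach [k] happy leaves to its middle vertex. If the happy leaves are spared,
   all swaps are adjacent transpositions of the path, so that at least
   [k (2k+1)] of them are needed to remove all inversions. With the leaves used
   as a buffer, exchanging one half of the path with the leaves (keeping the
   order) costs about [k^2 / 2] swaps, and three such exchanges (left half,
   right half, left half) followed by [O(k)] swaps on the star around the middle
   vertex sort the tokens. The ratio tends to [2 / (3/2) = 4/3]. *)

Require Import Defs.
From mathcomp Require Import all_boot all_order all_algebra all_fingroup.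
From mathcomp Require Import boolp classical_sets reals constructive_ereal ereal.
From mathcomp Require Import zify lra.

Set Implicit Arguments.
Unset Strict Implicit.
Unset Printing Implicit Defensive.

(** * Trees encoded by a parent function *)

Definition parent_edge (n : nat) (par : nat -> nat) : rel 'I_n :=
  [rel u v : 'I_n |
    (u < v) && (u == par v :> nat) || (v < u) && (v == par u :> nat)].

(* The largest vertex of a cycle would have two distinct smaller neighbours. *)
Lemma parent_edge_acyclic (n : nat) (par : nat -> nat) :
  acyclic (@parent_edge n par).
Proof.
move=> c c3 /andP[cyc uc].
case: c c3 cyc uc => [//|x0 c0]; set c := x0 :: c0 => c3 cyc uc.
have x0c : x0 \in c by rewrite mem_head.
case: (arg_maxnP (fun x : 'I_n => x : nat) x0c) => x xc xmax.
case/rot_to: xc => i [|y [|z s]] defc.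
- by move: c3; rewrite -(size_rot i) defc.
- by move: c3; rewrite -(size_rot i) defc.
have mem_rotc w : w \in [:: x, y, z & s] -> w \in c by rewrite -defc mem_rot.
move: cyc uc; rewrite -(rot_cycle i) -(rot_uniq i) defc.
(* [y] and [w] are the two cycle neighbours of the largest vertex [x]. Both lie below [x], so both
   edges force the value [par x]. *)
set w := last z s.
have wzs : w \in z :: s by exact: mem_last.
have -> : path.cycle (parent_edge par) [:: x, y, z & s] =
  parent_edge par x y && path (parent_edge par) y (rcons (z :: s) x) by [].
rewrite rcons_path => /and3P[exy _ ewx] /= /and3P[xnys yns _].
have wy : w != y by apply: contraNneq yns => <-.
have yx := xmax _ (mem_rotc y ltac:(by rewrite !inE eqxx orbT)).
have wx : (w <= x)%N.
  by apply: xmax; apply: mem_rotc; rewrite 2!in_cons wzs !orbT.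
case/negP: wy; apply/eqP/val_inj => /=.
by move: exy ewx; rewrite /parent_edge /= -/w; lia.
Qed.

Lemma parent_edge_tree (n : nat) (par : nat -> nat) :
  0 < n -> (forall v, 0 < v < n -> par v < v) -> is_tree (@parent_edge n par).
Proof.
case: n => [//|n] _ par_lt; split=> //.
- by move=> u v; rewrite /parent_edge /= orbC.
- by move=> u; rewrite /parent_edge /= ltnn.
- have sym : symmetric (@parent_edge n.+1 par).
    by move=> u v; rewrite /parent_edge /= orbC.
  suff to0 (m : nat) (v : 'I_n.+1) : v <= m -> connect (parent_edge par) v ord0.
    move=> u v; apply: connect_trans (to0 u u (leqnn _)) _.
    by rewrite (sym_connect_sym sym) (to0 v).
  elim: m v => [|m IHm] v vm.
    by rewrite (_ : v = ord0) ?connect0 //; apply/val_inj => /=; lia.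
  have [v0|v0] := posnP v; first by apply: IHm; lia.
  have lt_par : par v < v by apply: par_lt; rewrite v0 ltn_ord.
  have lt_parn : par v < n.+1 by apply: ltn_trans lt_par (ltn_ord v).
  apply: connect_trans (connect1 _) (IHm (Ordinal lt_parn) _) => /=; last by lia.
  by rewrite /parent_edge /= lt_par eqxx orbT.
- exact: parent_edge_acyclic.
Qed.

(** * Swap sequences as permutations, and routing through a hub *)

Section Routing.
Variable T : finType.
Implicit Types (s : seq (T * T)) (X L : nat -> T).

(* [origin s v] is the vertex from which [s] brings the token that ends on
   [v]. *)
Definition origin s : {perm T} :=
  foldr (fun uv q => q * tperm uv.1 uv.2)%g 1%g s.

Lemma origin_cat s1 s2 : origin (s1 ++ s2) = (origin s2 * origin s1)%g.
Proof. by elim: s1 => [|uv s1 IH] /=; rewrite ?mulg1 // IH mulgA. Qed.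

Lemma origin_rev s : origin (rev s) = (origin s)^-1%g.
Proof.
elim: s => [|uv s IH]; first by rewrite invg1.
by rewrite rev_cons -cats1 origin_cat /= IH invMg tpermV mul1g.
Qed.

(* Swaps along the path [X m, ..., X 0]: the token of [X m] goes to [X 0]
   and the others move away by one step. *)
Fixpoint pull X (m : nat) : seq (T * T) :=
  if m is m'.+1 then (X m'.+1, X m') :: pull X m' else [::].

(* Empties [X 1, ..., X m], in this order, into [L 1, ..., L m] through
   the hub [X 0 = L 0]. *)
Fixpoint unload X L (m : nat) : seq (T * T) :=
  if m is m'.+1 then
    unload X L m' ++ pull X m'.+1 ++ [:: (X 0, L m'.+1)]
  else [::].

Lemma edges_pull (e : rel T) X m : (forall i, i < m -> e (X i.+1) (X i)) ->
  all (fun uv => e uv.1 uv.2) (pull X m).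
Proof.
elim: m => //= m IH eX; rewrite eX //=.
by apply: IH => i im; apply: eX; rewrite ltnW.
Qed.

Lemma edges_unload (e : rel T) X L m :
  (forall i, i < m -> e (X i.+1) (X i)) ->
  (forall i, 0 < i <= m -> e (X 0) (L i)) ->
  all (fun uv => e uv.1 uv.2) (unload X L m).
Proof.
elim: m => //= m IH eX eL; rewrite all_cat IH ?eX //=.
- by rewrite all_cat /= edges_pull ?eX ?eL ?ltnSn // => i im; apply: eX; rewrite ltnW.
- by move=> i im; apply: eX; rewrite ltnW.
- by move=> i im; apply: eL; lia.
Qed.

Lemma size_pull X m : size (pull X m) = m.
Proof. by elim: m => //= m ->. Qed.

(** The token of [X i] needs [i] swaps to reach the hub and one more to enter its leaf. Doubling
    avoids dividing the sum of the [i + 1]. *)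
Lemma size_unload X L m : (size (unload X L m)).*2 = m * (m + 3).
Proof.
elim: m => //= m IH; rewrite size_cat /= size_cat size_pull /=.
by rewrite !doubleD !doubleS IH; nia.
Qed.

Lemma origin_pull X m : {in [pred i | i <= m] &, injective X} ->
  [/\ origin (pull X m) (X 0) = X m,
      forall j, j < m -> origin (pull X m) (X j.+1) = X j
    & forall v, (forall j, j <= m -> v <> X j) -> origin (pull X m) v = v].
Proof.
elim: m => [|m IH] injX /=; first by split=> // *; rewrite perm1.
have [|IH0 IHj IHv] := IH.
  by move=> i j im jm; apply: injX; rewrite inE leqW.
have neqX i j : i <= m.+1 -> j <= m.+1 -> i != j -> X i <> X j.
  by move=> im jm /eqP nij eqX; apply: nij; apply: injX.
split.
- by rewrite permM IH0 tpermR.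
- move=> j; rewrite ltnS leq_eqVlt => /orP[/eqP->|jm].
    rewrite permM IHv ?tpermL // => j' j'm; apply: neqX; lia.
  by rewrite permM IHj // tpermD //; apply/eqP; apply: neqX; lia.
- move=> v vX; rewrite permM IHv; last by move=> j jm; apply: vX; lia.
  by rewrite tpermD //; apply/eqP => /esym; apply: vX; lia.
Qed.

(** In each round the hub receives the old token of the current leaf, and later rounds push it
    outwards. Thus the displaced tokens fill the branch in reverse order, with the hub token at the
    far end. *)
Lemma origin_unload X L m : X 0 = L 0 ->
  {in [pred i | i <= m] &, injective X} ->
  {in [pred i | i <= m] &, injective L} ->
  (forall i j, 0 < i <= m -> j <= m -> X i <> L j) ->
  [/\ forall i, 0 < i <= m -> origin (unload X L m) (L i) = X i,
      forall j, j <= m -> origin (unload X L m) (X j) = L (m - j)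
    & forall v, (forall j, j <= m -> v <> X j) ->
                (forall j, j <= m -> v <> L j) -> origin (unload X L m) v = v].
Proof.
move=> X0; elim: m => [|m IH] injX injL neqXL.
  split=> [|[|j] //|v vX vL]; rewrite ?perm1 //; lia.
have [|||IHL IHX IHv] := IH.
- by move=> i j im jm; apply: injX; rewrite inE leqW.
- by move=> i j im jm; apply: injL; rewrite inE leqW.
- by move=> i j im jm; apply: neqXL; lia.
have neqX i j : i <= m.+1 -> j <= m.+1 -> i != j -> X i <> X j.
  by move=> im jm /eqP nij eqX; apply: nij; apply: injX.
have neqL i j : i <= m.+1 -> j <= m.+1 -> i != j -> L i <> L j.
  by move=> im jm /eqP nij eqL; apply: nij; apply: injL.
have neqLX i j : 0 < i <= m.+1 -> j <= m.+1 -> L i <> X j.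
  case: j => [|j] im jm; first by rewrite X0; apply: neqL; lia.
  by move/esym; apply: neqXL; lia.
have [P0 PX Pv] := origin_pull injX.
have originE v : origin (unload X L m.+1) v =
    origin (unload X L m) (origin (pull X m.+1) (tperm (X 0) (L m.+1) v)).
  by rewrite /= origin_cat /= origin_cat !permM /= perm1.
split.
- move=> i /andP[i0]; rewrite leq_eqVlt originE => /orP[/eqP->|im].
    rewrite tpermR P0 IHv // => j jm; first by apply: neqX; lia.
    by apply: neqXL; lia.
  rewrite tpermD; first last.
  + by apply/eqP; apply: neqL; lia.
  + by apply/eqP; rewrite X0; apply: neqL; lia.
  by rewrite Pv ?IHL //; [lia | move=> j jm; apply: neqLX; lia].
- move=> [|j] jm; rewrite originE.
    rewrite tpermL Pv; last by move=> j' ?; apply: neqLX; lia.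
    rewrite IHv ?subn0 // => j' ?; first by apply: neqLX; lia.
    by apply: neqL; lia.
  rewrite tpermD; first last.
  + by apply/eqP; apply: neqLX; lia.
  + by apply/eqP; apply: neqX; lia.
  by rewrite PX // IHX ?subSS.
- move=> v vX vL; rewrite originE tpermD; first last.
  + by apply/eqP => /esym; apply: vL.
  + by apply/eqP => /esym; apply: vX.
  rewrite Pv // IHv // => j jm; [apply: vX | apply: vL]; lia.
Qed.

(* A transposition of two leaves of a star costs three swaps. *)
Lemma star_sort (e : rel T) L m (q : {perm T}) :
  {in [pred i | i <= m] &, injective L} ->
  (forall i, 0 < i <= m -> e (L 0) (L i)) ->
  (forall v, (forall i, i <= m -> v <> L i) -> q v = v) ->
  exists s, [/\ all (fun uv => e uv.1 uv.2) s, size s <= 3 * m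
              & origin s = q].
Proof.
elim: m q => [|m IH] q injL eL fixq.
  exists [::]; split=> //=; apply/permP => v; rewrite perm1.
  case: (v =P L 0) => [->|vL]; last by rewrite fixq // => -[].
  apply/esym; apply: contrapT => qL.
  by apply: (qL); apply: (@perm_inj _ q); rewrite fixq // => -[].
have neqL i j : i <= m.+1 -> j <= m.+1 -> i != j -> L i <> L j.
  by move=> im jm /eqP nij eqL; apply: nij; apply: injL.
have swap_leaf v : (exists2 i, i <= m.+1 & v = L i) ->
    exists s, [/\ all (fun uv => e uv.1 uv.2) s, size s <= 3
              & origin s = tperm (L m.+1) v].
  move=> [i im ->].
  have [->|nim] := eqVneq i m.+1; first by exists [::]; rewrite tperm1.
  have [->|i0] := posnP i.
    by exists [:: (L 0, L m.+1)]; rewrite /= mul1g tpermC eL ?ltnSn.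
  (* Conjugating [(L 0, L m.+1)] by [(L 0, L i)] gives [(L i, L m.+1)]. *)
  exists [:: (L 0, L i); (L 0, L m.+1); (L 0, L i)]; split=> //=.
    by rewrite !eL //= ?i0.
  rewrite mul1g -mulgA -{1}(tpermV (L 0) (L i)) -conjgE tpermJ tpermL tpermD.
  + by rewrite tpermC.
  + by apply/eqP; apply: neqL; lia.
  + by apply/eqP; apply: neqL.
have [|s1 [es1 size1 or1]] := swap_leaf (q (L m.+1)).
  (* A vertex off the star is fixed by [q], so by injectivity it cannot be the image of [L m.+1]. *)
  apply: contrapT => qL.
  have qqL : q (q (L m.+1)) = q (L m.+1).
    by apply: fixq => i im qi; apply: qL; exists i.
  by apply: qL; exists m.+1 => //; apply: perm_inj qqL.
(* The extra factor makes the permutation fix [L m.+1], which leaves a star with one leaf fewer. *)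
have [|||s2 [es2 size2 or2]] := IH (q * tperm (L m.+1) (q (L m.+1)))%g.
- by move=> i j im jm; apply: injL; rewrite inE leqW.
- by move=> i im; apply: eL; lia.
- move=> v vL; rewrite permM.
  have [->|vm] := eqVneq v (L m.+1); first by rewrite tpermR.
  have qv : q v = v.
    apply: fixq => i; rewrite leq_eqVlt => /orP[/eqP->|/vL//]; exact/eqP.
  rewrite qv tpermD //; first by rewrite eq_sym.
  by apply: contraNneq vm => qL; apply/eqP/(@perm_inj _ q); rewrite qL.
exists (s1 ++ s2); split.
- by rewrite all_cat es1.
- by rewrite size_cat; lia.
- by rewrite origin_cat or1 or2 -mulgA -{1}(tpermV (L m.+1)) mulVg mulg1.
Qed.

End Routing.

(** Consequently [s] sorts [p] exactly when [origin s] is the inverse of [p]. *)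
Lemma run_origin (n : nat) (p : placement n) (s : swaps n) :
  run p s = (origin s * p)%g.
Proof. by elim: s p => [|uv s IH] p /=; rewrite ?mul1g // IH mulgA. Qed.

(** * Inversions under adjacent swaps *)

Definition inversions (n m : nat) (p : placement n) : {set 'I_n * 'I_n} :=
  [set ij : 'I_n * 'I_n | (ij.1 < ij.2 <= m) && (p ij.2 < p ij.1)].

(** Apart from the pair [(a, b)] itself, applying the transposition to both positions maps
    inversions injectively to inversions of the new placement. *)
Lemma inversions_swap (n m : nat) (p : placement n) (a b : 'I_n) :
  b = a.+1 :> nat -> b <= m ->
  #|inversions m p| <= #|inversions m (tperm a b * p)%g|.+1.
Proof.
move=> ab bm; set t := tperm a b.
pose f (ij : 'I_n * 'I_n) := (t ij.1, t ij.2).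
have injf : injective f by move=> [i j] [i' j'] [/perm_inj-> /perm_inj->].
rewrite (cardsD1 (a, b)) -(card_imset _ injf) -add1n leq_add ?leq_b1 //.
apply/subset_leq_card/fintype.subsetP => _ /imsetP[[i j] + ->].
rewrite !inE /= !permM !tpermK xpair_eqE => /and3P[nab /andP[ij jm] ->].
rewrite andbT /t; move: nab ij jm.
case: tpermP => [->|->|/eqP + /eqP +]; case: tpermP => [->|->|/eqP + /eqP +];
  rewrite -?val_eqE /=; lia.
Qed.

(** * The broom with a reversed path: lower and upper bounds *)

Section Broom.
Variable k : nat.

(* The path [0, ..., 2k] with [k] further leaves [2k+1, ..., 3k] attached to
   its middle vertex [k]. *)
Definition broom_parent (v : nat) : nat := if v <= k.*2 then v.-1 else k.

Definition broom : rel 'I_(3 * k).+1 := @parent_edge (3 * k).+1 broom_parent.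

Lemma broom_tree : is_tree broom.
Proof.
by apply: parent_edge_tree => // v; rewrite /broom_parent; case: ifP; lia.
Qed.

Definition flip_path (v : 'I_(3 * k).+1) : 'I_(3 * k).+1 :=
  if v <= k.*2 then inord (k.*2 - v) else v.

Lemma val_flip_path v :
  flip_path v = (if v <= k.*2 then k.*2 - v else v) :> nat.
Proof. by rewrite /flip_path; case: ifP => // vk; rewrite inordK //; lia. Qed.

Lemma flip_pathK : involutive flip_path.
Proof.
by move=> v; apply/val_inj; rewrite /= !val_flip_path; do 2!case: ifP; lia.
Qed.

Definition flip : placement (3 * k).+1 := perm (inv_inj flip_pathK).

Definition broom_instance : instance := Instance flip broom_tree.

(** All pairs of the [k.*2.+1] path vertices are inverted. *)
Lemma card_inversions_flip : #|inversions k.*2 flip| = k * k.*2.+1.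
Proof.
have -> : #|inversions k.*2 flip| =
    \sum_(j < (3 * k).+1) \sum_(i < (3 * k).+1) (i < j <= k.*2).
  rewrite -sum1_card big_mkcond exchange_big pair_bigA.
  apply: eq_bigr => -[i j] _.
  rewrite inE /= !permE !val_flip_path.
  case: (i < j <= k.*2) / andP => //= -[ij jk].
  by rewrite jk (ltnW (leq_trans ij jk)); case: ifP; lia.
have sum_ord (m : nat) (F : nat -> nat) : m <= (3 * k).+1 ->
    \sum_(i < (3 * k).+1) (i < m) * F i = \sum_(0 <= i < m) F i.
  move=> mk; rewrite big_mkord (big_ord_widen _ F mk) [RHS]big_mkcond.
  by apply: eq_bigr => i _; case: ifP; rewrite ?mul1n.
transitivity (\sum_(j < (3 * k).+1) (j < k.*2.+1) * j).
  apply: eq_bigr => j _; rewrite ltnS.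
  transitivity (\sum_(i < (3 * k).+1) (i < j) * (j <= k.*2)).
    by apply: eq_bigr => i _; rewrite mulnb.
  rewrite (sum_ord j (fun _ => _)); last exact: ltnW.
  by rewrite sum_nat_const_nat subn0 mulnC.
rewrite (sum_ord _ id); last by lia.
by rewrite bin2_sum bin2 /= mulnC -doubleMl doubleK mulnC.
Qed.

Lemma is_leaf_broom (v : 'I_(3 * k).+1) : k.*2 < v -> is_leaf broom v.
Proof.
move=> kv; apply/eqP; rewrite -[RHS](card1 (inord k : 'I_(3 * k).+1)).
apply: eq_card => w; rewrite !inE /broom /parent_edge /= /broom_parent.
rewrite -val_eqE /= inordK; last by lia.
by do 2!case: ifP; lia.
Qed.

(* The happy leaves around [k] stay frozen, so all swaps happen on the path. *)
Lemma sparing_inversions (p : placement (3 * k).+1) (s : swaps (3 * k).+1) :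
  (forall v : 'I__, k.*2 < v -> p v = v) ->
  on_edges broom s -> spares_happy_leaves broom p s ->
  (forall v, is_home (run p s) v) -> #|inversions k.*2 p| <= size s.
Proof.
elim: s p => [|[a b] s IH] p homeL /=.
  move=> _ _ homep; rewrite leqn0 cards_eq0 -finset.subset0; apply/fintype.subsetP => ij.
  by rewrite !inE !(eqP (homep _)); lia.
have not_leaf v : ~~ happy_leaf broom p v -> v <= k.*2.
  move=> nhv; rewrite leqNgt; apply: contra nhv => kv.
  by rewrite /happy_leaf is_leaf_broom //= /is_home homeL.
move=> /andP[eab es] /and3P[/not_leaf ak /not_leaf bk sp] homes.
have {}IH : #|inversions k.*2 (tperm a b * p)%g| <= size s.
  apply: IH => // v kv; rewrite permM tpermD ?homeL //.
    by rewrite -val_eqE /=; lia.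
  by rewrite -val_eqE /=; lia.
(* An edge with both ends on the path joins consecutive numbers. *)
have [ab|ba] : b = a.+1 :> nat \/ a = b.+1 :> nat.
- move: eab; rewrite /broom /parent_edge /= /broom_parent.
  by do 2!case: ifP; lia.
- by apply: leq_trans (inversions_swap _ ab bk) _.
- by apply: leq_trans (inversions_swap _ ba ak) _; rewrite tpermC.
Qed.

Lemma broom_sparing_size (s : swaps (nverts broom_instance)) :
  sorting s -> never_moves_happy_leaves s -> k * k.*2.+1 <= size s.
Proof.
move=> [es homes] sp; rewrite -card_inversions_flip.
apply: sparing_inversions => // v kv.
by apply/val_inj; rewrite permE /= val_flip_path leqNgt kv.
Qed.

(** All three sequences start at the middle vertex, which is the hub for [unload]; [A] and [B] run
    outwards along the two branches. *)
Let A (i : nat) : 'I_(3 * k).+1 := inord (k - i).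
Let B (i : nat) : 'I_(3 * k).+1 := inord (k + i).
Let L (i : nat) : 'I_(3 * k).+1 := inord (if i == 0 then k else k.*2 + i).

Let valA i : i <= k -> A i = k - i :> nat.
Proof. by move=> ik; rewrite inordK //; lia. Qed.

Let valB i : i <= k -> B i = k + i :> nat.
Proof. by move=> ik; rewrite inordK //; lia. Qed.

Let valL i : i <= k -> L i = (if i == 0 then k else k.*2 + i) :> nat.
Proof. by move=> ik; rewrite inordK //; case: ifP; lia. Qed.

(* Unloading the left branch into the leaves, loading the leaves into the
   right branch and unloading the left branch again exchanges the two branches;
   the [k+1] tokens that are then on the star around [k] are sorted last. *)
Lemma broom_short_sort : exists s : swaps (nverts broom_instance),
  sorting s /\ (size s).*2 <= 3 * k * (k + 5).
Proof.
have A0 : A 0 = L 0 by rewrite /A /L subn0.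
have B0 : B 0 = L 0 by rewrite /B /L addn0.
have injA : {in [pred i | i <= k] &, injective A}.
  move=> i j ik jk /(congr1 val) /=; rewrite !valA //.
  by move: ik jk; rewrite !inE; lia.
have injB : {in [pred i | i <= k] &, injective B}.
  move=> i j ik jk /(congr1 val) /=; rewrite !valB //.
  by move: ik jk; rewrite !inE; lia.
have injL : {in [pred i | i <= k] &, injective L}.
  move=> i j ik jk /(congr1 val) /=; rewrite !valL //; move: ik jk; rewrite !inE.
  by do 2!case: ifP; lia.
have neqAL i j : 0 < i <= k -> j <= k -> A i <> L j.
  move=> ik jk /(congr1 val) /=; rewrite valA ?valL //; last by lia.
  by case: ifP; lia.
have neqBL i j : 0 < i <= k -> j <= k -> B i <> L j.
  move=> ik jk /(congr1 val) /=; rewrite valB ?valL //; last by lia.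
  by case: ifP; lia.
have neqAB i j : 0 < i <= k -> j <= k -> A i <> B j.
  by move=> ik jk /(congr1 val) /=; rewrite valA ?valB //; lia.
have neqBA i j : 0 < i <= k -> j <= k -> B i <> A j.
  by move=> ik jk /(congr1 val) /=; rewrite valB ?valA //; lia.
have edgeE u v : broom u v = (u < v) && (u == broom_parent v :> nat)
                          || (v < u) && (v == broom_parent u :> nat) by [].
have eA i : i < k -> broom (A i.+1) (A i).
  move=> ik; rewrite edgeE !valA //; last by lia.
  by rewrite /broom_parent; do 2!case: ifP; lia.
have eB i : i < k -> broom (B i.+1) (B i).
  move=> ik; rewrite edgeE !valB //; last by lia.
  by rewrite /broom_parent; do 2!case: ifP; lia.
have eL i : 0 < i <= k -> broom (L 0) (L i).
  move=> ik; rewrite edgeE !valL //; last by lia.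
  by rewrite /broom_parent /=; do !case: ifP; lia.
have [ALA AX _] := origin_unload A0 injA injL neqAL.
have fixA i : 0 < i <= k -> origin (unload A L k) (B i) = B i.
  have [_ _ fixA ik] := origin_unload A0 injA injL neqAL.
  by apply: fixA => j jk; [apply: neqBA | apply: neqBL].
have [BLB BX _] := origin_unload B0 injB injL neqBL.
have fixB i : 0 < i <= k -> origin (unload B L k) (A i) = A i.
  have [_ _ fixB ik] := origin_unload B0 injB injL neqBL.
  by apply: fixB => j jk; [apply: neqAB | apply: neqAL].
pose s1 := unload A L k ++ rev (unload B L k) ++ unload A L k.
have origin1 v : origin s1 v = origin (unload A L k)
    ((origin (unload B L k))^-1%g (origin (unload A L k) v)).
  by rewrite !origin_cat origin_rev !permM.
(* Traced backwards, the token ending on [A i] comes from [L (k - i)], where it was before the last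
   unloading, and from [B i] before the loading. The two order reversals cancel. *)
have s1A i : 0 < i <= k -> origin s1 (A i) = B i.
  move=> ik; rewrite origin1 AX; last by lia.
  by rewrite -BX ?permK ?fixA //; lia.
have s1B i : 0 < i <= k -> origin s1 (B i) = A i.
  by move=> ik; rewrite origin1 fixA // -(BLB i ik) permK ALA.
have flipA i : 0 < i <= k -> flip (A i) = B i.
  move=> ik; apply/val_inj; rewrite permE /= val_flip_path /= valA ?valB; try by lia.
  by case: ifP; lia.
have flipB i : 0 < i <= k -> flip (B i) = A i.
  move=> ik; apply/val_inj; rewrite permE /= val_flip_path /= valB ?valA; try by lia.
  by case: ifP; lia.
have coverAB v : (forall i, i <= k -> v <> L i) ->
    exists2 i, 0 < i <= k & v = A i \/ v = B i.
  move=> vL.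
  have vk : v <= k.*2.
    rewrite leqNgt; apply/negP => kv; apply: (vL (v - k.*2)).
      by have := ltn_ord v; lia.
    by apply/val_inj; rewrite /= valL; [case: ifP; lia | have := ltn_ord v; lia].
  have nvk : (v : nat) <> k.
    by move=> v_k; apply: (vL 0) => //; apply/val_inj; rewrite /= valL.
  have [lt_vk|le_kv] := ltnP v k.
    exists (k - v); first by lia.
    by left; apply/val_inj; rewrite /= valA; lia.
  exists (v - k); first by lia.
  by right; apply/val_inj; rewrite /= valB; lia.
(* Both [flip] and [origin s1] exchange [A i] with [B i], so their quotient moves only vertices of
   the star. *)
have [|s2 [es2 size2 or2]] := star_sort (q := (flip * (origin s1)^-1)%g) injL eL.
  move=> v /coverAB[i ik [->|->]]; rewrite permM.
    by rewrite flipA // -s1A // permK.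
  by rewrite flipB // -s1B // permK.
exists (s1 ++ s2); split; first split.
- rewrite /on_edges !all_cat es2 all_rev andbT.
  have -> : all (fun uv => broom uv.1 uv.2) (unload A L k).
    by apply: edges_unload => // i ik; rewrite A0 eL.
  have -> // : all (fun uv => broom uv.1 uv.2) (unload B L k).
  by apply: edges_unload => // i ik; rewrite B0 eL.
- move=> v; rewrite /is_home run_origin origin_cat or2 mulgKV.
  by rewrite permM !permE flip_pathK.
(* Doubled, the three exchanges cost [3 * k * (k + 3)] and the star at most [6 * k]. *)
- rewrite !size_cat size_rev !doubleD !size_unload.
  by move: (size s2) size2 => m; clear; nia.
Qed.

End Broom.

(** * Optimal lengths and the limiting ratio *)

Lemma is_OPT_exists (I : instance) (s : swaps (nverts I)) : sorting s ->
  exists2 opt, is_OPT I opt & opt <= size s.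
Proof.
move=> sort_s.
have exP : exists m,
    `[< exists2 s' : swaps (nverts I), sorting s' & size s' = m >].
  by exists (size s); apply/asboolP; exists s.
case: (ex_minnP exP) => opt /asboolP opt_s opt_min.
exists opt; last by apply: opt_min; apply/asboolP; exists s.
by split=> // s' sort_s'; apply: opt_min; apply/asboolP; exists s'.
Qed.

Import Order.TTheory GRing.Theory Num.Theory.
Local Open Scope ring_scope.

Theorem theorem4p1 (R : realType) :
  (forall c : R, c < 4 / 3 ->
     exists (I : instance) (opt : nat),
       is_OPT I opt /\
       forall s : swaps (nverts I),
         sorting s -> never_moves_happy_leaves s ->
         c * opt%:R < (size s)%:R)
  /\
  (forall A : forall I : instance, swaps (nverts I),
     sorting_algorithm A ->
     (forall I : instance, never_moves_happy_leaves (A I)) ->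
     ((4 / 3 : R)%:E <= approx_factor R A)%E).
Proof.
have ratio (c : R) : c < 4 / 3 -> exists (I : instance) (opt : nat),
    is_OPT I opt /\ forall s : swaps (nverts I),
      sorting s -> never_moves_happy_leaves s -> c * opt%:R < (size s)%:R.
  move=> c43; have d0 : 0 < 4 - 3 * c by lra.
  (* [c * 3 k (k + 5) / 2 < k (2 k + 1)] amounts to [15 c - 2 < k (4 - 3 c)],
     where [15 c - 2 < 18]. *)
  pose k := (Num.bound (18 / (4 - 3 * c))).+1.
  have kd : 18 < k%:R * (4 - 3 * c).
    rewrite -ltr_pdivrMr // (lt_trans (archi_boundP _)) //.
      by rewrite divr_ge0 // ltW.
    by rewrite ltr_nat.
  have k0 : (0 : R) < k%:R by rewrite ltr0n.
  have [s0 [sort_s0 size_s0]] := broom_short_sort k.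
  have [opt optP opt_le] := is_OPT_exists sort_s0.
  exists (broom_instance k), opt; split=> // s sort_s sp.
  have : (k * k.*2.+1 <= size s)%N := broom_sparing_size sort_s sp.
  rewrite -(ler_nat R) => /(lt_le_trans _); apply.
  have {s0 sort_s0 size_s0 opt_le} : (opt * 2 <= 3 * k * (k + 5))%N by lia.
  rewrite -(ler_nat R) -addnn -addn1 !natrM !natrD => opt_le.
  have opt0 : (0 : R) <= opt%:R by rewrite ler0n.
  have [c0|c0] := leP c 0.
    by rewrite (@le_lt_trans _ _ 0) ?mulr_le0_ge0 // mulr_gt0 //; lra.
  have : c * (opt%:R * 2) <= c * (3 * k%:R * (k%:R + 5)).
    by rewrite ler_pM2l.
  nra.
split=> // A sortA spA; rewrite leNgt; apply/negP => lt43.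
have ratio_le (I : instance) (k : nat) : is_OPT I k -> (0 < k)%N ->
    (((size (A I))%:R / k%:R : R)%:E <= approx_factor R A)%E.
  by move=> optk k0; apply: ereal_sup_ubound; exists I, k.
have exceeds (c : R) : c < 4 / 3 ->
    exists2 q : R, c < q & (q%:E <= approx_factor R A)%E.
  move=> /ratio[I [k [optk ltk]]].
  (* If the optimum were 0, the empty sequence would sort and spare all leaves, against the strict
     inequality. *)
  have k0 : (0 < k)%N.
    rewrite lt0n; apply/eqP => k0; move: optk ltk; rewrite k0.
    move=> [[s sort_s /size0nil s0] _]; rewrite s0 in sort_s.
    by move=> /(_ _ sort_s isT); rewrite mulr0 ltxx.
  exists ((size (A I))%:R / k%:R); last exact: ratio_le.
  by rewrite ltr_pdivlMr ?ltr0n // ltk.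
(* A finite factor [r] below [4 / 3] is exceeded by the ratio obtained for [c := r]; for the value
   minus infinity, any ratio gives a contradiction. *)
move: lt43 exceeds; case: (approx_factor R A) => [r| |] //.
  rewrite lte_fin => r43 /(_ r r43)[q rq].
  by rewrite lee_fin leNgt rq.
have lt0 : (0 : R) < 4 / 3 by lra.
by move=> _ /(_ 0 lt0)[q _]; rewrite leeNy_eq.
Qed.
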